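(* For a zero-dimensional frame $L$, the following are equivalent. (1) $L$ is extremally disconnected (ED). (2) $L$ is $CL$-extremal (that is, $CL$ is a frame). (3) $CL=D_\infty CL=\mathfrak{B}L$. (4) $CL$ is a complete Boolean algebra. (5) The embedding of $CL$ into $L$ has a left adjoint. (6) $\lambda L$ is ED. (7) $\beta L$ is ED.
   Context: For a frame $L$, $a^*$ denotes the pseudocomplement of $a$, $CL$ the Boolean algebra of complemented elements of $L$, and $\mathfrak{B}L=\{x\in L: x=x^{**}\}$ the Booleanization. $L$ is zero-dimensional if every element is a join of elements of $CL$; such frames are completely regular. $L$ is extremally disconnected (ED) if $a^*\vee a^{**}=1$ for all $a\in L$, equivalently $\mathfrak{B}L=CL$. ''$CL$ is a frame'' refers to $CL$ in its own order. For a meet-semilattice $A$, a subset $G\subseteq A$ is admissible if $\bigvee G$ exists in $A$ and for each $a\in A$ the join $\bigvee\{a\wedge y:y\in G\}$ exists in $A$ and equals $a\wedge\bigvee G$; a downset $E$ of $A$ is a D-ideal if $\bigvee G\in E$ for each admissible $G\subseteq E$; $D_\infty A$ is the frame of D-ideals under inclusion. When $A$ is a base of $L$ closed under binary meets, $D_\infty A$ is identified with the sublocale $\{x\in L:\{a\in A:a\le x\}\text{ is a D-ideal of }A\}$ of $L$ (which contains $A$); this is applied to $A=CL$. In a completely regular frame, $x\prec\!\!\prec y$ (completely below) means there are $c_q$ ($q\in\mathbb{Q}\cap[0,1]$) with $c_0=x$, $c_1=y$, and $c_p^*\vee c_q=1$ for $p<q$. $\mathrm{Coz}\,L$ is the $\sigma$-frame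 of cozero elements, i.e. elements of the form $\bigvee\{a_n: n\in\mathbb{N}\}$ with $a_n\prec\!\!\prec a_{n+1}$ for all $n$. $\lambda L$, the Lindelöf (regular) coreflection of $L$, is the frame of $\sigma$-ideals of $\mathrm{Coz}\,L$ (downsets closed under countable joins). $\beta L$, the compact regular coreflection of $L$, is the frame of ideals $I$ of $L$ such that each $x\in I$ satisfies $x\prec\!\!\prec y$ for some $y\in I$. *)

(* Defs.v *)
From HB Require Import structures.
From mathcomp Require Import all_boot all_order all_algebra.
From mathcomp Require Import all_classical.

Set Implicit Arguments.
Unset Strict Implicit.
Unset Printing Implicit Defensive.

Import Order.TTheory.

Local Open Scope classical_set_scope.
Local Open Scope order_scope.

Definition isGlb d (T : porderType d) (A : set T) (m : T) : Prop :=
  lbound A m /\ forall b, lbound A b -> b <= m.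

Definition complete_order d (T : porderType d) : Prop :=
  forall S : set T, (exists s, isLub S s) /\ (exists i, isGlb S i).

(* The property of being a frame for an order that is not known to be
   complete; frames given as structures are the [frameType]s below. *)
Definition frame_order d (T : meetSemilatticeType d) : Prop :=
  complete_order T /\
  forall (a : T) (S : set T) (s : T),
    isLub S s -> isLub [set a `&` x | x in S] (a `&` s).

HB.mixin Record TBDistrLattice_isFrame d L of Order.TBDistrLattice d L := {
  fsup : set L -> L;
  fsupP : forall S : set L, isLub S (fsup S);
  meet_fsup : forall (a : L) (S : set L),
    a `&` fsup S = fsup [set a `&` x | x in S]
}.

#[short(type="frameType")]
HB.structure Definition Frame d :=
  { L of TBDistrLattice_isFrame d L & Order.TBDistrLattice d L }.

HB.factory Record POrder_isFrame d L of Order.POrder d L := {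
  meet : L -> L -> L;
  meetP : forall x y z : L, (x <= meet y z) = (x <= y) && (x <= z);
  sup : set L -> L;
  supP : forall S : set L, isLub S (sup S);
  meet_sup : forall (a : L) (S : set L),
    meet a (sup S) <= sup [set meet a x | x in S]
}.

HB.builders Context d L of POrder_isFrame d L.

Let bot := sup set0.
Let top := sup setT.
Let join (x y : L) := sup [set x; y].

Fact le0x (x : L) : bot <= x.
Proof. by have [_] := supP set0; apply=> y. Qed.

Fact lex1 (x : L) : x <= top.
Proof. by have [+ _] := supP setT; apply. Qed.

Fact leUx (x y z : L) : (join x y <= z) = (x <= z) && (y <= z).
Proof.
have [ub lb] := supP [set x; y].
apply/idP/andP => [h|[xz yz]].
  by split; apply: le_trans h; apply: ub; [left|right].
by apply: lb => _ [->|->].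
Qed.

HB.instance Definition _ := Order.hasBottom.Build d L le0x.
HB.instance Definition _ := Order.hasTop.Build d L lex1.
HB.instance Definition _ := Order.POrder_isMeetSemilattice.Build d L meetP.
HB.instance Definition _ := Order.POrder_isJoinSemilattice.Build d L leUx.

Fact frame_meetUl :
  @left_distributive L L (@Order.meet d L) (@Order.join d L).
Proof.
move=> x y z; apply/eqP; rewrite eq_le; apply/andP; split; last first.
  by rewrite leUx !lexI !leIr !andbT !(le_trans (leIl _ _)) ?leUl ?leUr.
rewrite [_ `&` z]meetC; apply: le_trans (meet_sup _ _) _.
have [_] := supP [set meet z w | w in [set x; y]]; apply.
have meetz w : meet z w = w `&` z by rewrite meetC.
by move=> _ [w [->|->] <-]; rewrite meetz ?leUl ?leUr.
Qed.

HB.instance Definition _ :=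
  Order.Lattice_Meet_isDistrLattice.Build d L frame_meetUl.

Fact frame_meet_fsup (a : L) (S : set L) :
  a `&` sup S = sup [set a `&` x | x in S].
Proof.
apply/eqP; rewrite eq_le meet_sup /=.
have [_] := supP [set a `&` x | x in S]; apply=> _ [x Sx <-].
rewrite lexI leIl /= (le_trans (leIr _ _)) //.
by have [+ _] := supP S; apply.
Qed.

HB.instance Definition _ :=
  TBDistrLattice_isFrame.Build d L supP frame_meet_fsup.

HB.end.

Definition pseudocompl d (L : frameType d) (a : L) : L :=
  fsup [set x | a `&` x = \bot].

Notation "a ^*" := (pseudocompl a) : frame_scope.
Delimit Scope frame_scope with Fr.
Local Open Scope frame_scope.

Section FrameNotions.
Context {d : Order.disp_t} {L : frameType d}.

Definition complemented (x : L) : Prop :=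
  exists y, x `&` y = \bot /\ x `|` y = \top.

(* [x] is completely below [y]; the values of [c] outside [0, 1] are
   irrelevant. *)
Definition cbelow (x y : L) : Prop :=
  exists c : rat -> L, [/\ c 0%R = x, c 1%R = y &
    forall p q : rat, (0 <= p)%R -> (p < q)%R -> (q <= 1)%R ->
      (c p)^* `|` c q = \top].

Definition cozero (x : L) : Prop :=
  exists a : nat -> L, (forall n, cbelow (a n) (a n.+1)) /\ x = fsup (range a).

(* A sigma-ideal of Coz L, as a subset of L. Joins in Coz L of countable
   families are joins in L; the empty family gives [I \bot]. *)
Definition sigma_ideal (I : set L) : Prop :=
  [/\ I `<=` cozero,
      (forall x y, cozero x -> x <= y -> I y -> I x) &
      (forall S, countable S -> S `<=` I -> I (fsup S))].

Definition ideal (I : set L) : Prop :=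
  [/\ I \bot,
      (forall x y, x <= y -> I y -> I x) &
      (forall x y, I x -> I y -> I (x `|` y))].

Definition regular_ideal (I : set L) : Prop :=
  ideal I /\ forall x, I x -> exists2 y, I y & cbelow x y.

End FrameNotions.

Definition extremally_disconnected d (L : frameType d) : Prop :=
  forall a : L, a^* `|` a^*^* = \top.

Definition CL d (L : frameType d) : set L := [set x | complemented x].

Definition booleanization d (L : frameType d) : set L := [set x | x = x^*^*].

Arguments CL {d} L.
Arguments booleanization {d} L.

Definition zero_dimensional d (L : frameType d) : Prop :=
  forall x : L, exists2 S : set L, S `<=` CL L & x = fsup S.

Section DIdeals.
Context {d : Order.disp_t} {A : meetSemilatticeType d}.

Definition admissible (G : set A) : Prop :=
  exists2 s, isLub G s & forall a, isLub [set a `&` y | y in G] (a `&` s).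

Definition D_ideal (E : set A) : Prop :=
  (forall x y, x <= y -> E y -> E x) /\
  (forall G s, admissible G -> G `<=` E -> isLub G s -> E s).

End DIdeals.

(* D_oo A as a sublocale of L, for a base A of L included through [e]. *)
Definition D_infty d (L : frameType d) d' (A : meetSemilatticeType d')
    (e : A -> L) : set L :=
  [set x | D_ideal [set a | e a <= x]].

Definition has_left_adjoint d (T : porderType d) d' (U : porderType d')
    (g : T -> U) : Prop :=
  exists2 f : U -> T, {homo f : x y / x <= y} &
    forall x y, (f x <= y) = (x <= g y).

Section FrameTheory.
Context {d : Order.disp_t} {L : frameType d}.
Implicit Types (x y z : L) (S : set L).

Lemma fsup_ub S x : S x -> x <= fsup S.
Proof. by have [+ _] := fsupP S; apply. Qed.

Lemma fsup_le S y : (forall x, S x -> x <= y) -> fsup S <= y.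
Proof. by have [_] := fsupP S; apply. Qed.

Lemma meet_pseudocompl x : x `&` x^* = \bot.
Proof.
apply/eqP; rewrite -lex0 meet_fsup; apply: fsup_le => _ [y /= xy0 <-].
by rewrite xy0.
Qed.

Lemma pseudocompl_max x y : x `&` y = \bot -> y <= x^*.
Proof. by move=> xy0; apply: fsup_ub. Qed.

Lemma pseudocompl_anti x y : x <= y -> y^* <= x^*.
Proof.
move=> xy; apply: pseudocompl_max; apply/eqP; rewrite -lex0.
by rewrite -(meet_pseudocompl y) leI2.
Qed.

Lemma pseudocomplU x y : x^* `&` y^* <= (x `|` y)^*.
Proof.
apply: pseudocompl_max; rewrite meetUl.
rewrite meetA meet_pseudocompl meet0x [_^* `&` _]meetC meetA.
by rewrite meet_pseudocompl meet0x joinxx.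
Qed.

Lemma complementedP x : complemented x -> x `|` x^* = \top.
Proof.
move=> [y [xy0 xy1]]; apply/eqP; rewrite -le1x -xy1 leU2 //.
exact: pseudocompl_max.
Qed.

Lemma complementedC x : complemented x -> complemented x^*.
Proof.
move=> cx; exists x; rewrite meetC joinC.
by rewrite meet_pseudocompl complementedP.
Qed.

Lemma complementedI x y : complemented x -> complemented y ->
  complemented (x `&` y).
Proof.
move=> /complementedP cx /complementedP cy; exists (x^* `|` y^*); split.
  rewrite meetUr meetAC meet_pseudocompl meet0x -meetA.
  by rewrite meet_pseudocompl meetx0 joinxx.
apply/eqP; rewrite -le1x joinIl lexI; apply/andP; split.
  by rewrite -cx leU2 ?leUl.
by rewrite -cy leU2 ?leUr.
Qed.

Lemma complementedU x y : complemented x -> complemented y ->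
  complemented (x `|` y).
Proof.
move=> /complementedP cx /complementedP cy; exists (x^* `&` y^*); split.
  by apply/eqP; rewrite -lex0 -(meet_pseudocompl (x `|` y)) leI2 ?pseudocomplU.
apply/eqP; rewrite -le1x joinIr lexI; apply/andP; split.
  by rewrite -cx leU2 ?leUl.
by rewrite -cy leU2 ?leUr.
Qed.

Lemma complemented0 : complemented (\bot : L).
Proof. by exists \top; rewrite meet0x join0x. Qed.

Lemma complemented1 : complemented (\top : L).
Proof. by exists \bot; rewrite meetx0 joinx0. Qed.

Lemma cbelow_le x y : cbelow x y -> x <= y.
Proof.
move=> [c [<- <- /(_ 0%R 1%R)]] => /(_ isT isT isT) h.
rewrite -[c 0%R]meetx1 -h meetUr meet_pseudocompl join0x.
exact: leIr.
Qed.

Lemma cbelow0 : cbelow (\bot : L) \bot.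
Proof.
exists (fun=> \bot); split=> // p q _ _ _; apply/eqP; rewrite joinx0 -le1x.
by apply: pseudocompl_max; rewrite meet0x.
Qed.

Lemma cbelow1 : cbelow (\top : L) \top.
Proof. by exists (fun=> \top); split=> // p q _ _ _; rewrite joinx1. Qed.

Lemma cbelow_mono x y z w : x <= y -> cbelow y z -> z <= w -> cbelow x w.
Proof.
move=> xy [c [c0 c1 cP]] zw.
exists (fun p => if p == 0%R then x else if p == 1%R then w else c p).
split=> // p q p0 pq q1; apply/eqP; rewrite -le1x -(cP p q p0 pq q1).
apply: leU2.
  apply: pseudocompl_anti; case: eqP => [->|_]; first by rewrite c0.
  by case: eqP pq q1 => // -> /lt_le_trans /[apply]; rewrite ltxx.
case: eqP => [q0|_]; last by case: eqP => [->|//]; rewrite c1.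
by move: pq; rewrite q0 => /(le_lt_trans p0); rewrite ltxx.
Qed.

Lemma cbelowU x y z w : cbelow x y -> cbelow z w -> cbelow (x `|` z) (y `|` w).
Proof.
move=> [c [<- <- cP]] [e [<- <- eP]].
exists (fun p => c p `|` e p); split=> // p q p0 pq q1.
apply/eqP; rewrite -le1x.
apply: le_trans (leU2 (pseudocomplU _ _) (lexx _)).
rewrite joinIl lexI -{1}(cP p q p0 pq q1) -(eP p q p0 pq q1).
by rewrite !leU2 ?leUl ?leUr.
Qed.

Lemma cbelowI x y z w : cbelow x y -> cbelow z w -> cbelow (x `&` z) (y `&` w).
Proof.
move=> [c [<- <- cP]] [e [<- <- eP]].
exists (fun p => c p `&` e p); split=> // p q p0 pq q1.
apply/eqP; rewrite -le1x joinIr lexI.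
rewrite -{1}(cP p q p0 pq q1) -(eP p q p0 pq q1).
by rewrite !leU2 ?pseudocompl_anti ?leIl ?leIr.
Qed.

Lemma cozero0 : cozero (\bot : L).
Proof.
exists (fun=> \bot); split=> [_|]; first exact: cbelow0.
by apply/eqP; rewrite eq_le le0x fsup_le // => _ [_ _ <-].
Qed.

Lemma cozero1 : cozero (\top : L).
Proof.
exists (fun=> \top); split=> [_|]; first exact: cbelow1.
by apply/eqP; rewrite eq_le lex1 fsup_ub //; exists 0%N.
Qed.

Lemma cbelow_chain (a : nat -> L) : (forall n, cbelow (a n) (a n.+1)) ->
  {homo a : m n / (m <= n)%N >-> m <= n}.
Proof.
by move=> aP; apply: homo_leq le_trans _ => // n; apply: cbelow_le.
Qed.

Lemma cozeroI x y : cozero x -> cozero y -> cozero (x `&` y).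
Proof.
move=> [a [aP ->]] [b [bP ->]]; exists (fun n => a n `&` b n).
split=> [n|]; first exact: cbelowI.
apply/eqP; rewrite eq_le; apply/andP; split.
  rewrite meet_fsup; apply: fsup_le => _ [_ [m _ <-] <-].
  rewrite meetC meet_fsup; apply: fsup_le => _ [_ [n _ <-] <-].
  have h : (a (maxn m n) `&` b (maxn m n)) <=
      fsup (range (fun n => a n `&` b n)) by apply: fsup_ub; exists (maxn m n).
  apply: le_trans h; rewrite meetC; apply: leI2.
    by apply: cbelow_chain => //; rewrite leq_maxr.
  by apply: cbelow_chain => //; rewrite leq_maxl.
apply: fsup_le => _ [n _ <-]; rewrite leI2 // fsup_ub //; by exists n.
Qed.

Lemma cozero_fsup S : countable S -> S `<=` cozero -> cozero (fsup S).
Proof.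
move=> cS Scoz.
have [S0|/set0P S0] := eqVneq S set0.
  have -> : fsup S = \bot by apply/eqP; rewrite -lex0 fsup_le // S0.
  exact: cozero0.
have [f fS Sf] : exists2 f : nat -> L, (forall n, S (f n)) &
    forall x, S x -> exists n, f n = x.
  case: S0 => x0 Sx0.
  have /countable_injP[g ginj] := cS.
  pose P n x := S x /\ g x = n.
  pose f n := xget x0 (P n).
  exists f => [n|x Sx]; first by rewrite /f; case: xgetP => // x _ [].
  exists (g x); rewrite /f; case: xgetP => [y _ [Sy gy]|/(_ x)]; last by case.
  by apply: ginj; rewrite ?inE.
have /choice[a aP] : forall n, exists a : nat -> L,
    (forall m, cbelow (a m) (a m.+1)) /\ f n = fsup (range a).
  by move=> n; apply: Scoz.
pose b k := \join_(n < k) a n k.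
have ab n m k : (n < k)%N -> (m <= k)%N -> a n m <= b k.
  move=> nk mk; apply: le_trans (_ : a n k <= _).
    by apply: cbelow_chain mk; case: (aP n).
  exact: (@joins_sup _ _ _ (Ordinal nk) xpredT (fun n : 'I_k => a n k)).
exists b; split=> [k|].
  apply: (@cbelow_mono _ (b k) (\join_(n < k) a n k.+1)) => //.
    rewrite /b; elim/big_ind2: _ => [|*|i _]; first exact: cbelow0.
      exact: cbelowU.
    by case: (aP i).
  apply/joinsP => i _; apply: ab => //.
  exact: leqW.
apply/eqP; rewrite eq_le; apply/andP; split.
  apply: fsup_le => x /Sf[n <-]; have [_ ->] := aP n.
  apply: fsup_le => _ [m _ <-].
  apply: le_trans (@ab n m (maxn n.+1 m) _ _) _; rewrite ?leq_maxl ?leq_maxr //.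
  by apply: fsup_ub; exists (maxn n.+1 m).
apply: fsup_le => _ [k _ <-]; apply/joinsP => i _.
apply: le_trans (_ : f i <= _); last exact: fsup_ub.
by have [_ ->] := aP i; apply: fsup_ub; exists k.
Qed.

End FrameTheory.

(* CL as a type with its own order; [CLval] is its embedding into L. *)
Definition complementedb d (L : frameType d) : {pred L} :=
  fun x => `[< complemented x >].

Arguments complementedb {d} L.

Record CL_type d (L : frameType d) := CLElt {
  CLval :> L;
  CLvalP : CLval \in complementedb L
}.

HB.instance Definition _ d (L : frameType d) := [isSub for @CLval d L].
HB.instance Definition _ d (L : frameType d) := [Choice of CL_type L by <:].

Section CLInstances.
Context {d : Order.disp_t} {L : frameType d}.

Fact complementedbI : meet_closed (complementedb L).
Proof.
move=> x y /asboolP cx /asboolP cy; apply/asboolP; exact: complementedI.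
Qed.

Fact complementedbU : join_closed (complementedb L).
Proof.
move=> x y /asboolP cx /asboolP cy; apply/asboolP; exact: complementedU.
Qed.

Fact complementedb0 : \bot \in complementedb L.
Proof. apply/asboolP; exact: complemented0. Qed.

Fact complementedb1 : \top \in complementedb L.
Proof. apply/asboolP; exact: complemented1. Qed.

HB.instance Definition _ :=
  @Order.SubChoice_isTBSubLattice.Build d L (complementedb L) d (CL_type L)
    complementedbI complementedbU complementedb0 complementedb1.

Fact CL_meetUl : @left_distributive (CL_type L) (CL_type L)
  (@Order.meet _ _) (@Order.join _ _).
Proof. by move=> x y z; apply: val_inj => /=; apply: meetUl. Qed.

HB.instance Definition _ :=
  Order.Lattice_Meet_isDistrLattice.Build d (CL_type L) CL_meetUl.

Fact CL_compl_subproof (x : CL_type L) : (val x)^* \in complementedb L.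
Proof.
by apply/asboolP; apply: complementedC; apply/asboolP; apply: (valP x).
Qed.

Definition CL_compl (x : CL_type L) : CL_type L := CLElt (CL_compl_subproof x).

Fact CL_joinxC x : x `|` CL_compl x = \top.
Proof.
by apply: val_inj; apply: complementedP; apply/asboolP; apply: (valP x).
Qed.

Fact CL_meetxC x : x `&` CL_compl x = \bot.
Proof. by apply: val_inj; apply: meet_pseudocompl. Qed.

HB.instance Definition _ :=
  Order.TBDistrLattice_hasComplement.Build d (CL_type L) CL_joinxC CL_meetxC.

End CLInstances.

Definition sigma_idealb d (L : frameType d) : pred (set L) :=
  fun I => `[< sigma_ideal I >].

(* lambda L, ordered by inclusion *)
Record lindelof d (L : frameType d) := Lindelof {
  lindelof_val :> set L;
  lindelof_valP : sigma_idealb lindelof_val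
}.

HB.instance Definition _ d (L : frameType d) := [isSub for @lindelof_val d L].
HB.instance Definition _ d (L : frameType d) := [Choice of lindelof L by <:].
HB.instance Definition _ d (L : frameType d) :=
  [SubChoice_isSubPOrder of lindelof L by <: with d].

(* The sigma-ideal generated by [X], provided [X `<=` cozero]. *)
Inductive sigma_gen d (L : frameType d) (X : set L) : L -> Prop :=
| SigmaBase x of X x : sigma_gen X x
| SigmaDown x y of cozero x & x <= y & sigma_gen X y : sigma_gen X x
| SigmaSup S of countable S & (forall x, S x -> sigma_gen X x) :
    sigma_gen X (fsup S).

Section LindelofInstances.
Context {d : Order.disp_t} {L : frameType d}.
Implicit Types (I J : lindelof L) (SS : set (lindelof L)).

Lemma lindelofP I : sigma_ideal I.
Proof. by have /asboolP := lindelof_valP I. Qed.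

Lemma lindelof_leP I J : reflect (I `<=` J) (I <= J).
Proof. by apply: (iffP idP) => /asboolP. Qed.

Fact lindelof_meet_subproof I J : sigma_idealb (I `&` J)%classic.
Proof.
have [I1 I2 I3] := lindelofP I; have [J1 J2 J3] := lindelofP J.
apply/asboolP; split=> [x [/I1]//|x y cx xy [Iy Jy]|S cS SIJ].
  by split; [apply: I2 Iy|apply: J2 Jy].
by split; [apply: I3 => // x /SIJ[]|apply: J3 => // x /SIJ[]].
Qed.

Definition lindelof_meet I J : lindelof L :=
  Lindelof (lindelof_meet_subproof I J).

Fact lindelof_sup_subproof SS :
  sigma_idealb (sigma_gen (\bigcup_(I in SS) (I : set L))).
Proof.
apply/asboolP; split=> [x|x y|S]; last 2 first.
- by move=> cx xy; apply: SigmaDown.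
- by move=> cS SI; apply: SigmaSup.
elim=> {x} [x [I _ Ix]|//|S cS _ IH]; last exact: cozero_fsup.
by have [+ _ _] := lindelofP I; apply.
Qed.

Definition lindelof_sup SS : lindelof L := Lindelof (lindelof_sup_subproof SS).

Fact lindelof_meetP I J K : (I <= lindelof_meet J K) = (I <= J) && (I <= K).
Proof.
apply/lindelof_leP/andP => [h|[/lindelof_leP IJ /lindelof_leP IK] x Ix].
  by split; apply/lindelof_leP => x /h[].
by split; [apply: IJ|apply: IK].
Qed.

Fact lindelof_supP SS : isLub SS (lindelof_sup SS).
Proof.
split=> [I SI|J ubJ]; apply/lindelof_leP => x.
  by move=> Ix; apply: SigmaBase; exists I.
have [_ J2 J3] := lindelofP J.
elim=> {x} [x [I /ubJ /lindelof_leP + Ix]|x y cx xy _|S cS _ IH]; first exact.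
- exact: J2.
- exact: J3.
Qed.

Fact lindelof_meet_sup I SS :
  lindelof_meet I (lindelof_sup SS) <=
  lindelof_sup [set lindelof_meet I J | J in SS].
Proof.
apply/lindelof_leP => x [Ix /= gx].
have [I1 I2 I3] := lindelofP I.
suff h y a : sigma_gen (\bigcup_(I in SS) (I : set L)) y -> (I : set L) a ->
    sigma_gen (\bigcup_(J in [set lindelof_meet I J | J in SS]) (J : set L))
      (a `&` y).
  by rewrite -[x]meetxx; apply: h.
move=> gy Ia; have ca := I1 _ Ia.
elim: gy => {y} [y [J SJ Jy]|y z cy yz _ IH|S cS gS IH].
- have [J1 J2 _] := lindelofP J; apply: SigmaBase.
  exists (lindelof_meet I J); first by exists J.
  have cay : cozero (a `&` y) by apply: cozeroI => //; apply: J1.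
  by split; [apply: I2 Ia; rewrite ?leIl|apply: J2 Jy; rewrite ?leIr].
- by apply: SigmaDown IH; [apply: cozeroI|rewrite leI2].
- rewrite meet_fsup; apply: SigmaSup => [|_ [y Sy <-]]; last exact: IH.
  by apply: sub_countable cS; apply: card_image_le.
Qed.

HB.instance Definition _ := POrder_isFrame.Build d (lindelof L)
  lindelof_meetP lindelof_supP lindelof_meet_sup.

End LindelofInstances.

Definition regular_idealb d (L : frameType d) : pred (set L) :=
  fun I => `[< regular_ideal I >].

(* beta L, ordered by inclusion *)
Record stone_cech d (L : frameType d) := StoneCech {
  stone_cech_val :> set L;
  stone_cech_valP : regular_idealb stone_cech_val
}.

HB.instance Definition _ d (L : frameType d) :=
  [isSub for @stone_cech_val d L].
HB.instance Definition _ d (L : frameType d) := [Choice of stone_cech L by <:].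
HB.instance Definition _ d (L : frameType d) :=
  [SubChoice_isSubPOrder of stone_cech L by <: with d].

Inductive ideal_gen d (L : frameType d) (X : set L) : L -> Prop :=
| IdealBase x of X x : ideal_gen X x
| IdealBot : ideal_gen X \bot
| IdealDown x y of x <= y & ideal_gen X y : ideal_gen X x
| IdealJoin x y of ideal_gen X x & ideal_gen X y : ideal_gen X (x `|` y).

Section StoneCechInstances.
Context {d : Order.disp_t} {L : frameType d}.
Implicit Types (I J : stone_cech L) (SS : set (stone_cech L)).

Lemma stone_cechP I : regular_ideal I.
Proof. by have /asboolP := stone_cech_valP I. Qed.

Lemma stone_cech_leP I J : reflect (I `<=` J) (I <= J).
Proof. by apply: (iffP idP) => /asboolP. Qed.

Fact stone_cech_meet_subproof I J : regular_idealb (I `&` J)%classic.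
Proof.
have [[I1 I2 I3] I4] := stone_cechP I; have [[J1 J2 J3] J4] := stone_cechP J.
apply/asboolP; split; [split=> //|].
- by move=> x y xy [Iy Jy]; split; [apply: I2 Iy|apply: J2 Jy].
- by move=> x y [Ix Jx] [Iy Jy]; split; [apply: I3|apply: J3].
move=> x [/I4[y Iy xy] /J4[z Jz xz]]; exists (y `&` z).
  by split; [apply: I2 Iy; rewrite leIl|apply: J2 Jz; rewrite leIr].
by rewrite -[x]meetxx; apply: cbelowI.
Qed.

Definition stone_cech_meet I J : stone_cech L :=
  StoneCech (stone_cech_meet_subproof I J).

Fact stone_cech_sup_subproof SS :
  regular_idealb (ideal_gen (\bigcup_(I in SS) (I : set L))).
Proof.
apply/asboolP; split; [split|].
- exact: IdealBot.
- by move=> x y; apply: IdealDown.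
- by move=> x y; apply: IdealJoin.
move=> x; elim=> {x} [x [I SI Ix]||x y xy _ [z gz yz]|x y _ [z gz xz] _ [w gw yw]].
- have [_ /(_ _ Ix)[y Iy xy]] := stone_cechP I.
  by exists y => //; apply: IdealBase; exists I.
- by exists \bot; [apply: IdealBot|apply: cbelow0].
- by exists z => //; apply: cbelow_mono xy yz _.
- by exists (z `|` w); [apply: IdealJoin|apply: cbelowU].
Qed.

Definition stone_cech_sup SS : stone_cech L :=
  StoneCech (stone_cech_sup_subproof SS).

Fact stone_cech_meetP I J K :
  (I <= stone_cech_meet J K) = (I <= J) && (I <= K).
Proof.
apply/stone_cech_leP/andP => [h|[/stone_cech_leP IJ /stone_cech_leP IK] x Ix].
  by split; apply/stone_cech_leP => x /h[].
by split; [apply: IJ|apply: IK].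
Qed.

Fact stone_cech_supP SS : isLub SS (stone_cech_sup SS).
Proof.
split=> [I SI|J ubJ]; apply/stone_cech_leP => x.
  by move=> Ix; apply: IdealBase; exists I.
have [[J1 J2 J3] _] := stone_cechP J.
elim=> {x} [x [I /ubJ /stone_cech_leP + Ix]||x y xy _|x y _ Jx _ Jy] //.
- exact.
- exact: J2.
- exact: J3.
Qed.

Fact stone_cech_meet_sup I SS :
  stone_cech_meet I (stone_cech_sup SS) <=
  stone_cech_sup [set stone_cech_meet I J | J in SS].
Proof.
apply/stone_cech_leP => x [Ix /= gx].
have [[I1 I2 I3] _] := stone_cechP I.
suff h y a : ideal_gen (\bigcup_(I in SS) (I : set L)) y -> (I : set L) a ->
    ideal_gen (\bigcup_(J in [set stone_cech_meet I J | J in SS]) (J : set L))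
      (a `&` y).
  by rewrite -[x]meetxx; apply: h.
move=> gy Ia; elim: gy => {y} [y [J SJ Jy]||y z yz _ IH|y z _ IHy _ IHz].
- have [[_ J2 _] _] := stone_cechP J; apply: IdealBase.
  exists (stone_cech_meet I J); first by exists J.
  by split; [apply: I2 Ia; rewrite leIl|apply: J2 Jy; rewrite leIr].
- by rewrite meetx0; apply: IdealBot.
- by apply: IdealDown IH; rewrite leI2.
- by rewrite meetUr; apply: IdealJoin.
Qed.

HB.instance Definition _ := POrder_isFrame.Build d (stone_cech L)
  stone_cech_meetP stone_cech_supP stone_cech_meet_sup.

End StoneCechInstances.

(* Main.v *)
Require Import Defs.
From mathcomp Require Import all_boot all_order.
From mathcomp Require Import boolp classical_sets cardinality.

Set Implicit Arguments.
Unset Strict Implicit.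
Unset Printing Implicit Defensive.

Import Order.Theory.

Local Open Scope classical_set_scope.
Local Open Scope order_scope.
Local Open Scope frame_scope.

(** The hub of the equivalence is completeness of [CL L].

    Completeness against extremal disconnectedness: if [L] is extremally
    disconnected, the pseudocomplement of any element is complemented, so the
    double pseudocomplement of the join in [L] of a family of complemented
    elements is its join in [CL L].  Conversely, let [s] be the join in [CL L]
    of the complemented elements below [a].  As [L] is zero-dimensional,
    [a <= s], and the complemented elements disjoint from [a] are exactly those
    disjoint from [s]; hence [a^* = s^*] is complemented.  The same join [s],
    as a function of [a], is the left adjoint of the inclusion of [CL L]
    ([CL_join_adjoint]).  A complete Boolean algebra is a frame, so every
    subset of a complete [CL L] is admissible and every D-ideal of it has a
    greatest element; an [x] in [D_infty] is therefore the greatest complemented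
    element below itself.

    Both coreflections map onto [L] by sending an ideal to its join.  This is a
    dense quotient map, so it commutes with pseudocomplements, and every
    complemented element of [L] is the image of a complemented one (the ideal
    of what lies below it).  Such maps preserve and reflect extremal
    disconnectedness ([dense_quotient_ED]). *)

(** * Pseudocomplements and complemented elements *)

Section Pseudocomplements.
Context {d : Order.disp_t} {L : frameType d}.
Implicit Types (x y a c : L) (S : set L).

Lemma pseudocomplP a x : (x <= a^*) = (a `&` x == \bot).
Proof.
apply/idP/eqP => [h|]; last exact: pseudocompl_max.
by apply/eqP; rewrite -lex0 -(meet_pseudocompl a) leI2.
Qed.

Lemma le_pseudocomplC a x : (x <= a^*) = (a <= x^*).
Proof. by rewrite !pseudocomplP meetC. Qed.

Lemma le_pseudocomplK x : x <= x^*^*.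
Proof. by rewrite le_pseudocomplC. Qed.

Lemma pseudocompl3 x : x^*^*^* = x^*.
Proof.
by apply/eqP; rewrite eq_le le_pseudocomplK pseudocompl_anti ?le_pseudocomplK.
Qed.

Lemma complementedK c : complemented c -> c^*^* = c.
Proof.
move=> /complementedP cc; apply/eqP; rewrite eq_le le_pseudocomplK andbT.
rewrite -[leLHS]meetx1 -cc meetUr [_ `&` c^*]meetC meet_pseudocompl joinx0.
exact: leIr.
Qed.

Lemma le_fsupP S a : (fsup S <= a) <-> (forall x, S x -> x <= a).
Proof.
split=> [h x Sx|]; last exact: fsup_le.
by apply: le_trans h; apply: fsup_ub.
Qed.

Lemma EDP : extremally_disconnected L <-> forall a : L, complemented a^*.
Proof.
split=> ed a; last exact/complementedP.
by exists a^*^*; rewrite meet_pseudocompl ed.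
Qed.

Lemma complemented_cbelow c : complemented c -> cbelow c c.
Proof.
by move=> /complementedP cc; exists (fun=> c); split=> // *; rewrite joinC.
Qed.

Lemma complemented_cozero c : complemented c -> cozero c.
Proof.
move=> cc; exists (fun=> c); split=> [_|]; first exact: complemented_cbelow.
apply/eqP; rewrite eq_le fsup_ub ?fsup_le //; last by exists 0%N.
by move=> _ [_ _ <-].
Qed.

Lemma fsup_setI S T :
  (forall x y, S x -> T y -> (S `&` T)%classic (x `&` y)) ->
  fsup (S `&` T)%classic = fsup S `&` fsup T.
Proof.
move=> h; apply/eqP; rewrite eq_le lexI !fsup_le => [/=|x []|x []]; last 2 first.
- by move=> _ Tx; apply: fsup_ub.
- by move=> Sx _; apply: fsup_ub.
rewrite meetC meet_fsup; apply/le_fsupP => _ [x Sx <-].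
rewrite meetC meet_fsup; apply/le_fsupP => _ [y Ty <-].
by apply: fsup_ub; apply: h.
Qed.

End Pseudocomplements.

(** * Completeness of the algebra of complemented elements *)

Section Complete.

Lemma complete_orderP d (T : porderType d) :
  (forall S : set T, exists s, isLub S s) -> complete_order T.
Proof.
move=> lubT S; split; first exact: lubT.
have [i [ubi lei]] := lubT (lbound S).
by exists i; split=> // x Sx; apply: lei => y; apply.
Qed.

(** Meeting with [a] has the right adjoint [b |-> b `|` ~` a] in a Boolean
    algebra, so it preserves all the joins that exist. *)
Lemma boolean_meet_lub d (T : ctbDistrLatticeType d) (a : T) (S : set T) s :
  isLub S s -> isLub [set a `&` x | x in S] (a `&` s).
Proof.
move=> [ubs les]; split=> [_ [x Sx <-]|b ubb]; first by rewrite leI2 // ubs.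
have adj x : (a `&` x <= b) = (x <= ~` a `|` b).
  by rewrite -leBLR diffE complK meetC.
by rewrite adj; apply: les => x Sx; rewrite -adj; apply: ubb; exists x.
Qed.

Lemma boolean_complete_frame d (T : ctbDistrLatticeType d) :
  complete_order T -> frame_order T.
Proof. by move=> cT; split=> // a S s; apply: boolean_meet_lub. Qed.

Context {d : Order.disp_t} {L : frameType d}.
Implicit Types (a b : L) (c e : CL_type L).

Lemma CLval_complemented c : complemented (val c).
Proof. exact/asboolP/(valP c). Qed.

Lemma CLval_le c e : (val c <= val e) = (c <= e).
Proof. by []. Qed.

Lemma complemented_CLval a : complemented a -> exists c : CL_type L, val c = a.
Proof. by move=> /asboolP ca; exists (CLElt ca). Qed.

Lemma ED_complete_CL : extremally_disconnected L -> complete_order (CL_type L).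
Proof.
move=> /EDP ed; apply: complete_orderP => S.
have [s vs] := complemented_CLval (ed (fsup (val @` S))^*).
exists s; split=> [c Sc|b ubb]; rewrite -CLval_le vs.
  by apply: le_trans (le_pseudocomplK _); apply: fsup_ub; exists c.
rewrite -(complementedK (CLval_complemented b)).
do 2!apply: pseudocompl_anti.
by apply/le_fsupP => _ [c Sc <-]; rewrite CLval_le ubb.
Qed.

Hypothesis L0dim : zero_dimensional L.

Lemma zero_dimensional_le a b :
  (a <= b) <-> (forall c, val c <= a -> val c <= b).
Proof.
split=> [ab c ca|h]; first exact: le_trans ab.
have [S SC aE] := L0dim a; rewrite aE; apply/le_fsupP => x Sx.
have [c cE] := complemented_CLval (SC _ Sx).
by rewrite -cE; apply: h; rewrite cE aE; apply: fsup_ub.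
Qed.

(** By zero-dimensionality [a] is the join in [L] of the set whose join in
    [CL L] is [s], so both have the same upper bounds in [CL L]. *)
Lemma CL_join_adjoint a (s : CL_type L) :
  isLub [set c | val c <= a] s -> forall c, (s <= c) = (a <= val c).
Proof.
move=> [ubs les] c; apply/idP/idP => [sc|ac].
  apply/zero_dimensional_le => e ea.
  by rewrite CLval_le; apply: le_trans sc; apply: ubs.
by apply: les => e /= ea; rewrite -CLval_le; apply: le_trans ac.
Qed.

Lemma complete_CL_left_adjoint :
  complete_order (CL_type L) -> has_left_adjoint (@CLval d L).
Proof.
move=> cC.
have /choice[f fP] : forall a, exists s : CL_type L, isLub [set c | val c <= a] s.
  by move=> a; have [] := cC [set c | val c <= a].
have adj a c : (f a <= c) = (a <= val c) by apply: CL_join_adjoint.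
by exists f => // a b ab; rewrite adj (le_trans ab) // -adj.
Qed.

(** A left adjoint of the inclusion carries joins of [L] to joins of [CL L]. *)
Lemma left_adjoint_complete_CL :
  has_left_adjoint (@CLval d L) -> complete_order (CL_type L).
Proof.
move=> [f _ adj]; apply: complete_orderP => S; exists (f (fsup (val @` S))).
split=> [c Sc|b ubb].
  rewrite -CLval_le.
  apply: le_trans (_ : _ <= fsup (val @` S)) _; last by rewrite -adj.
  by apply: fsup_ub; exists c.
by rewrite adj; apply/le_fsupP => _ [c Sc <-]; rewrite CLval_le ubb.
Qed.

(** Both [a^*] and [s^*] lie above the same complemented elements: [c] is
    disjoint from [a] iff [a] is below the complement of [c], iff [s] is. *)
Lemma complete_CL_ED : complete_order (CL_type L) -> extremally_disconnected L.
Proof.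
move=> cC; apply/EDP => a.
have [[s /CL_join_adjoint sP] _] := cC [set c | val c <= a].
suff -> : a^* = (val s)^* by apply/complementedC/CLval_complemented.
apply/eqP; rewrite eq_le [X in _ && X]pseudocompl_anti ?andbT; last by rewrite -sP.
apply/zero_dimensional_le => c.
by rewrite (le_pseudocomplC a) (le_pseudocomplC (val s))
  -[(val c)^*]/(val (CL_compl c)) CLval_le sP.
Qed.

(** * D-ideals of complemented elements *)

(** The complemented elements below [x] form an admissible set, so the D-ideal
    condition puts their join [s] below [x]; [x <= s] by zero-dimensionality. *)
Lemma complete_CL_D_infty :
  complete_order (CL_type L) -> CL L = D_infty (@CLval d L).
Proof.
move=> cC; apply/seteqP; split=> x /=.
  move=> /complemented_CLval[c <-]; split=> [a b ab|G s _ Gc [_ les]] /=.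
    by apply: le_trans; rewrite CLval_le.
  by rewrite CLval_le; apply: les => a /Gc; rewrite /= CLval_le.
move=> [_ Dx].
have [[s sP] _] := cC [set c | val c <= x].
have adm : admissible [set c : CL_type L | val c <= x].
  by exists s => // a; apply: boolean_meet_lub.
suff -> : x = val s by apply: CLval_complemented.
apply/eqP; rewrite eq_le -(CL_join_adjoint sP) lexx /=.
exact: Dx adm _ sP.
Qed.

End Complete.

Lemma ED_CL_booleanization d (L : frameType d) :
  extremally_disconnected L <-> CL L = booleanization L.
Proof.
split=> [/EDP ed|CB].
  apply/seteqP; split=> x => [/complementedK/esym //|->]; exact: ed.
apply/EDP => a; suff : CL L a^* by [].
by rewrite CB /booleanization /= pseudocompl3.
Qed.

(** * Dense quotients *)

(** An onto frame homomorphism reflecting [\bot]; preservation of [\bot] and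
    [\top] follows from surjectivity. *)
Record dense_quotient d (M : frameType d) d' (L : frameType d') (h : M -> L) :
    Prop := DenseQuotient {
  dense_quotientI : {morph h : x y / x `&` y};
  dense_quotientU : {morph h : x y / x `|` y};
  dense_quotient_dense : forall x, h x = \bot -> x = \bot;
  dense_quotient_surj : forall a, exists x, h x = a
}.

Section DenseQuotient.
Context d (M : frameType d) d' (L : frameType d') (h : M -> L).
Hypothesis hP : dense_quotient h.

Lemma dense_quotient_mono x y : x <= y -> h x <= h y.
Proof. by move=> xy; rewrite -(join_r xy) (dense_quotientU hP) leUl. Qed.

Lemma dense_quotient0 : h \bot = \bot.
Proof.
have [x hx] := dense_quotient_surj hP \bot.
by apply/eqP; rewrite -lex0 -hx dense_quotient_mono.
Qed.

Lemma dense_quotient1 : h \top = \top.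
Proof.
have [x hx] := dense_quotient_surj hP \top.
by apply/eqP; rewrite -le1x -hx dense_quotient_mono.
Qed.

Lemma dense_quotient_disjoint x y : (x `&` y == \bot) = (h x `&` h y == \bot).
Proof.
rewrite -(dense_quotientI hP); apply/eqP/eqP => [->|]; first exact: dense_quotient0.
exact: dense_quotient_dense.
Qed.

(** By density disjointness is visible in the quotient, and by surjectivity
    the largest element disjoint from [h x] is an image. *)
Lemma dense_quotient_pseudocompl x : h x^* = (h x)^*.
Proof.
apply/eqP; rewrite eq_le pseudocomplP -dense_quotient_disjoint -pseudocomplP lexx.
have [y hy] := dense_quotient_surj hP (h x)^*.
rewrite -hy; apply: dense_quotient_mono.
by rewrite pseudocomplP dense_quotient_disjoint -pseudocomplP hy.
Qed.

Hypothesis h_lift : forall c, complemented c ->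
  exists2 x, complemented x & h x = c.

(** Upwards, a complemented lift [y] of [(h x)^*] satisfies [y <= x^*] and
    [y^* <= x^*^*], again because disjointness is visible in the quotient. *)
Lemma dense_quotient_ED : extremally_disconnected M <-> extremally_disconnected L.
Proof.
split=> [ed a|/EDP ed x].
  have [x <-] := dense_quotient_surj hP a.
  by rewrite -!dense_quotient_pseudocompl -(dense_quotientU hP) ed dense_quotient1.
have [y /complementedP yy hy] := h_lift (ed (h x)).
apply/eqP; rewrite -le1x -yy leU2 // pseudocomplP dense_quotient_disjoint.
  by rewrite hy meet_pseudocompl.
by rewrite !dense_quotient_pseudocompl hy meet_pseudocompl.
Qed.

End DenseQuotient.

(** * The Lindelof coreflection *)

Section Lindelof.
Context {d : Order.disp_t} {L : frameType d}.
Implicit Types (I J : lindelof L) (a c : L).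

Lemma principal_sigma_ideal a : sigma_idealb [set x | cozero x /\ x <= a].
Proof.
apply/asboolP; split=> [x []//|x y cx xy [_ ya]|S cS SI].
  by split=> //; apply: le_trans ya.
by split; [apply: cozero_fsup => // x /SI[]|apply/le_fsupP => x /SI[]].
Qed.

Definition lindelof_principal a : lindelof L := Lindelof (principal_sigma_ideal a).

(** Left adjoint to [lindelof_principal], by [lindelof_join_le]. *)
Definition lindelof_join I : L := fsup (I : set L).

Lemma lindelof_join_le I a : (lindelof_join I <= a) = (I <= lindelof_principal a).
Proof.
have [Icoz _ _] := lindelofP I.
apply/idP/lindelof_leP => [/le_fsupP h x Ix|h].
  by split; [apply: Icoz|apply: h].
by apply/le_fsupP => x /h[].
Qed.

Lemma lindelof_join_mono I J : I <= J -> lindelof_join I <= lindelof_join J.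
Proof.
by move=> IJ; rewrite lindelof_join_le (le_trans IJ) // -lindelof_join_le.
Qed.

Lemma lindelof_memU I J x y :
  (I : set L) x -> (J : set L) y -> (I `|` J : set L) (x `|` y).
Proof.
move=> Ix Jy.
have IU := lindelof_leP _ _ (leUl I J); have JU := lindelof_leP _ _ (leUr J I).
have [_ _ Usup] := lindelofP (I `|` J).
have -> : x `|` y = fsup [set x; y].
  apply/eqP; rewrite eq_le leUx !fsup_ub ?fsup_le //=; [|by right|by left].
  by move=> _ [->|->]; rewrite ?leUl ?leUr.
apply: Usup => [|_ [->|->]]; [|exact: IU|exact: JU].
exact: finite_set_countable.
Qed.

Lemma lindelof_join_dense_quotient :
  zero_dimensional L -> dense_quotient lindelof_join.
Proof.
move=> L0dim; split=> [I J|I J|I I0|a].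
- apply: fsup_setI => x y Ix Jy.
  have [I1 I2 _] := lindelofP I; have [J1 J2 _] := lindelofP J.
  have cxy : cozero (x `&` y) by apply: cozeroI; [apply: I1|apply: J1].
  by split; [apply: I2 Ix|apply: J2 Jy]; rewrite ?leIl ?leIr.
- apply/eqP; rewrite eq_le lindelof_join_le !leUx -!lindelof_join_le leUl leUr.
  by rewrite !lindelof_join_mono ?leUl ?leUr.
- apply/eqP; rewrite -lex0; apply/lindelof_leP => x Ix.
  have -> : x = fsup set0.
    apply/eqP; rewrite eq_le [X in _ && X]fsup_le // andbT.
    by rewrite (le_trans (fsup_ub Ix)) // [fsup _]I0.
  by have [_ _] := lindelofP (\bot : lindelof L); apply.
- exists (lindelof_principal a); apply/eqP; rewrite eq_le lindelof_join_le lexx /=.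
  apply/(zero_dimensional_le L0dim) => c ca; apply: fsup_ub; split=> //.
  exact/complemented_cozero/CLval_complemented.
Qed.

Lemma lindelof_join_lift : zero_dimensional L ->
  forall c, complemented c -> exists2 I, complemented I & lindelof_join I = c.
Proof.
move=> L0dim c cc; have hP := lindelof_join_dense_quotient L0dim.
have joinP a : complemented a -> lindelof_join (lindelof_principal a) = a.
  move=> ca; apply/eqP; rewrite eq_le lindelof_join_le lexx /= fsup_ub //.
  by split=> //; apply: complemented_cozero.
have cc' := complementedC cc.
exists (lindelof_principal c); last exact: joinP.
exists (lindelof_principal c^*); split; apply/eqP.
  by rewrite (dense_quotient_disjoint hP) !joinP // meet_pseudocompl.
rewrite -le1x; apply/lindelof_leP => x Ix.
have [/(_ _ Ix) cx _ _] := lindelofP (\top : lindelof L).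
have [_ Udown _] := lindelofP (lindelof_principal c `|` lindelof_principal c^*).
apply: Udown cx (lex1 x) _; rewrite -(complementedP cc).
by apply: lindelof_memU; split=> //; apply: complemented_cozero.
Qed.

End Lindelof.

(** * The compact regular coreflection *)

Section StoneCech.
Context {d : Order.disp_t} {L : frameType d}.
Implicit Types (I J : stone_cech L) (a c : L).

(** The complemented element [c] is there to make the ideal regular, as
    [c] is completely below itself.  The set of all [x] completely below [a]
    would need an interpolation argument. *)
Lemma clopen_regular_ideal a :
  regular_idealb [set x : L | exists c : CL_type L, x <= val c <= a].
Proof.
apply/asboolP; split; first split.
- by exists \bot; rewrite /= le0x /= le0x.
- move=> x y xy [c /andP[yc ca]]; by exists c; rewrite (le_trans xy yc).
- move=> x y [c /andP[xc ca]] [e /andP[ye ea]]; exists (c `|` e).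
  by rewrite /= leU2 //= leUx ca.
move=> x [c /andP[xc ca]]; exists (val c); first by exists c; rewrite lexx.
by apply: cbelow_mono xc (complemented_cbelow (CLval_complemented c)) (lexx _).
Qed.

Definition clopen_ideal a : stone_cech L := StoneCech (clopen_regular_ideal a).

Definition stone_cech_join I : L := fsup (I : set L).

Lemma stone_cech_join_le I J : I <= J -> stone_cech_join I <= stone_cech_join J.
Proof.
by move=> /stone_cech_leP IJ; apply/le_fsupP => x /IJ; apply: fsup_ub.
Qed.

Lemma stone_cech_memU I J x y :
  (I : set L) x -> (J : set L) y -> (I `|` J : set L) (x `|` y).
Proof.
move=> Ix Jy.
have IU := stone_cech_leP _ _ (leUl I J); have JU := stone_cech_leP _ _ (leUr J I).
have [[_ _ UU] _] := stone_cechP (I `|` J).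
by apply: UU; [apply: IU|apply: JU].
Qed.

Lemma stone_cech_join_sup (SS : set (stone_cech L)) a :
  (forall I, SS I -> stone_cech_join I <= a) ->
  stone_cech_join (stone_cech_sup SS) <= a.
Proof.
move=> h; apply/le_fsupP => x; elim=> {x} [x [I SI Ix]||x y xy _|x y _ xa _ ya].
- by apply: le_trans (h _ SI); apply: fsup_ub.
- exact: le0x.
- exact: le_trans.
- by rewrite leUx xa.
Qed.

Lemma stone_cech_join_clopen_le a : stone_cech_join (clopen_ideal a) <= a.
Proof. by apply/le_fsupP => x [c /andP[xc]]; apply: le_trans. Qed.

Lemma stone_cech_join_dense_quotient :
  zero_dimensional L -> dense_quotient stone_cech_join.
Proof.
move=> L0dim; split=> [I J|I J|I I0|a].
- apply: fsup_setI => x y Ix Jy.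
  have [[_ I2 _] _] := stone_cechP I; have [[_ J2 _] _] := stone_cechP J.
  by split; [apply: I2 Ix|apply: J2 Jy]; rewrite ?leIl ?leIr.
- apply/eqP; rewrite eq_le leUx !stone_cech_join_le ?leUl ?leUr // !andbT.
  have [ub _] := stone_cech_supP [set I; J].
  apply: (@le_trans _ _ (stone_cech_join (stone_cech_sup [set I; J]))).
    by apply: stone_cech_join_le; rewrite leUx !ub //; [right|left].
  by apply: stone_cech_join_sup => _ [->|->]; rewrite ?leUl ?leUr.
- apply/eqP; rewrite -lex0; apply/stone_cech_leP => x Ix.
  have [[b0 _ _] _] := stone_cechP (\bot : stone_cech L).
  suff -> : x = \bot by [].
  by apply/eqP; rewrite -lex0 (le_trans (fsup_ub Ix)) // [fsup _]I0.
- exists (clopen_ideal a); apply/eqP; rewrite eq_le stone_cech_join_clopen_le /=.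
  apply/(zero_dimensional_le L0dim) => c ca; apply: fsup_ub.
  by exists c; rewrite lexx.
Qed.

Lemma stone_cech_join_lift : zero_dimensional L ->
  forall c, complemented c -> exists2 I, complemented I & stone_cech_join I = c.
Proof.
move=> L0dim c cc; have hP := stone_cech_join_dense_quotient L0dim.
have mem a : complemented a -> (clopen_ideal a : set L) a.
  by move=> /complemented_CLval[e <-]; exists e; rewrite lexx.
have joinP a : complemented a -> stone_cech_join (clopen_ideal a) = a.
  move=> ca; apply/eqP; rewrite eq_le stone_cech_join_clopen_le /= fsup_ub //.
  exact: mem.
have cc' := complementedC cc.
exists (clopen_ideal c); last exact: joinP.
exists (clopen_ideal c^*); split; apply/eqP.
  by rewrite (dense_quotient_disjoint hP) !joinP // meet_pseudocompl.
rewrite -le1x; apply/stone_cech_leP => x _.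
have [[_ Udown _] _] := stone_cechP (clopen_ideal c `|` clopen_ideal c^*).
apply: Udown (lex1 x) _; rewrite -(complementedP cc).
by apply: stone_cech_memU; apply: mem.
Qed.

End StoneCech.

Theorem theorem6p5 (d : Order.disp_t) (L : frameType d)
    (L0dim : zero_dimensional L) :
  [<-> extremally_disconnected L;
       frame_order (CL_type L);
       CL L = D_infty (@CLval d L) /\
         D_infty (@CLval d L) = booleanization L;
       complete_order (CL_type L);
       has_left_adjoint (@CLval d L);
       extremally_disconnected (lindelof L);
       extremally_disconnected (stone_cech L)].
Proof.
have lamED := dense_quotient_ED (lindelof_join_dense_quotient L0dim)
  (lindelof_join_lift L0dim).
have betaED := dense_quotient_ED (stone_cech_join_dense_quotient L0dim)
  (stone_cech_join_lift L0dim).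
tfae.
- by move=> /ED_complete_CL; apply: boolean_complete_frame.
- move=> [cC _]; have CLD := complete_CL_D_infty L0dim cC.
  by split=> //; rewrite -CLD; apply/ED_CL_booleanization/complete_CL_ED.
- move=> [CLD DB]; apply/ED_complete_CL/ED_CL_booleanization.
  by rewrite CLD.
- exact: complete_CL_left_adjoint.
- by move=> /left_adjoint_complete_CL /(complete_CL_ED L0dim) /lamED.
- by move=> /lamED /betaED.
- by move=> /betaED.
Qed.
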